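(* Let $\Delta=\operatorname{conv}\{0,\alpha(1),\dots,\alpha(n)\}\subset\mathbb{R}^n$ be an $n$-dimensional even simplex, let $y\in\operatorname{int}(\Delta)\cap\mathbb{N}^n$ with $y=\sum_{j=1}^n\lambda_j\alpha(j)$, $\lambda_j>0$, $\lambda_0=1-\sum_{j=1}^n\lambda_j>0$, and let $$f=\lambda_0+\sum_{j=1}^n b_j\mathbf{x}^{\alpha(j)}+c\,\mathbf{x}^y\in P_{n,2d}^y .$$ Then $$f\in\Sigma_{n,2d}^y\quad\text{if and only if}\quad y\in\Delta^*\ \text{ or }\ \big(c>0\text{ and }y\in(2\mathbb{N})^n\big).$$ Furthermore, if $f\in\Sigma_{n,2d}^y$, then $f$ is a sum of binomial squares.
   Context: $\mathbb{N}=\{0,1,2,\dots\}$. A lattice simplex is even if all its vertices lie in $(2\mathbb{N})^n$. $P_\Delta^y$ is the set of real polynomials $b_0+\sum_{j=1}^n b_j\mathbf{x}^{\alpha(j)}+c\,\mathbf{x}^y$ with all $b_j>0$ and $c\in\mathbb{R}\setminus\{0\}$. $P_{n,2d}$ is the cone of polynomials in $\mathbb{R}[x_1,\dots,x_n]$ of degree at most $2d$ that are nonnegative on $\mathbb{R}^n$, $\Sigma_{n,2d}\subseteq P_{n,2d}$ the cone of sums of squares of real polynomials of degree at most $d$; $P_{n,2d}^y=P_{n,2d}\cap P_\Delta^y$ and $\Sigma_{n,2d}^y=\Sigma_{n,2d}\cap P_\Delta^y$. Mediated sets: let $\hat\Delta=\{0,\alpha(1),\dots,\alpha(n)\}$ be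 the vertex set of $\Delta$. For $L\subseteq\Delta\cap\mathbb{Z}^n$ put $\overline{A}(L)=\{\tfrac12(s+t)\in\mathbb{Z}^n: s\ne t,\ s,t\in L\cap(2\mathbb{Z})^n\}$. $L$ is called $\hat\Delta$-mediated if $\hat\Delta\subseteq L\subseteq\overline{A}(L)\cup\hat\Delta$. $\Delta^*$ denotes the (unique) maximal $\hat\Delta$-mediated set, i.e. the $\hat\Delta$-mediated set containing every $\hat\Delta$-mediated set. A sum of binomial squares is a sum of squares of real polynomials each having at most two terms (squares of single monomials are allowed). *)

(* Defs.v *)
From mathcomp Require Import all_boot all_order all_algebra.
(* mpoly must be loaded before mathcomp-analysis: the notations clash in the
   other order. *)
From mathcomp Require Import mpoly.
From mathcomp Require Import boolp classical_sets reals topology normedtype.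

Set Implicit Arguments.
Unset Strict Implicit.
Unset Printing Implicit Defensive.

Import Order.TTheory GRing.Theory Num.Theory.

Local Open Scope classical_set_scope.
Local Open Scope ring_scope.

Section LatticePoints.
Variable n : nat.

Definition mnm_pt (m : 'X_{1..n}) : 'rV[int]_n := \row_i (m i)%:Z.

Definition real_pt (R : realType) (z : 'rV[int]_n) : 'rV[R]_n :=
  map_mx (fun k : int => k%:~R) z.

(* (2N)^n *)
Definition even_mnm (m : 'X_{1..n}) : Prop := forall i, ~~ odd (m i).

(* (2Z)^n *)
Definition even_pt (z : 'rV[int]_n) : Prop := forall i, (2 %| z 0%R i)%Z.

End LatticePoints.

Definition conv (R : realType) (n k : nat) (v : 'I_k -> 'rV[R]_n) :
    set 'rV[R]_n :=
  [set x | exists w : 'I_k -> R,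
     [/\ forall i, 0 <= w i, \sum_i w i = 1 & x = \sum_i w i *: v i]].

Definition affinely_independent (R : realType) (n k : nat)
    (v : 'I_k.+1 -> 'rV[R]_n) : bool :=
  row_free (\matrix_(i < k) (v (lift ord0 i) - v ord0)).

Section Simplex.
Variables (R : realType) (n : nat) (alpha : 'I_n -> 'X_{1..n}).

(* The vertex with index 0 is the origin; the vertex with index j + 1 is
   alpha j. *)
Definition vertex (j : 'I_n.+1) : 'rV[int]_n :=
  if unlift ord0 j is Some k then mnm_pt (alpha k) else 0.

Definition vertices : set 'rV[int]_n := range vertex.

Definition simplex : set 'rV[R]_n := conv (fun j => real_pt R (vertex j)).

(* Affine independence of the n + 1 vertices says that conv of the vertices is
   an n-dimensional simplex; the vertex 0 is even without any condition. *)
Definition even_simplex : Prop :=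
  affinely_independent (fun j => real_pt R (vertex j)) /\
  forall j, even_mnm (alpha j).

(* Midpoints z = (s + t)/2 that are integral, written as z + z = s + t. *)
Definition midpoints (L : set 'rV[int]_n) : set 'rV[int]_n :=
  [set z | exists s t : 'rV[int]_n,
     [/\ s <> t, L s /\ even_pt s, L t /\ even_pt t & z + z = s + t]].

Definition mediated (L : set 'rV[int]_n) : Prop :=
  [/\ L `<=` [set z | simplex (real_pt R z)],
      vertices `<=` L & L `<=` midpoints L `|` vertices].

Definition maximal_mediated (L : set 'rV[int]_n) : Prop :=
  mediated L /\ forall L', mediated L' -> L' `<=` L.

Definition Delta_star : set 'rV[int]_n :=
  \bigcup_(L in [set L | mediated L]) L.

Lemma vertices_mediated : mediated vertices.
Proof.
split; [move=> z [j _ <-] | by [] | by move=> z Vz; right].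
exists (fun i => (i == j)%:R); split=> [i||].
- exact: ler0n.
- by rewrite (bigD1 j)//= eqxx big1 ?addr0// => i /negPf ->.
- rewrite (bigD1 j)//= eqxx scale1r big1 ?addr0// => i /negPf ->.
  by rewrite scale0r.
Qed.

Lemma Delta_star_maximal : maximal_mediated Delta_star.
Proof.
split=> [|L mL z Lz]; last by exists L.
split=> [z [L [sL _ _]] /sL//|z Vz|z [L mL Lz]].
  by exists vertices; first exact: vertices_mediated.
have [_ _ /(_ _ Lz) [|]] := mL; last by right.
move=> [s [t [st [Ls es] [Lt et] e]]]; left; exists s, t.
by split=> //; split=> //; exists L.
Qed.

Lemma maximal_mediated_unique (L : set 'rV[int]_n) :
  maximal_mediated L -> L = Delta_star.
Proof.
have [mD maxD] := Delta_star_maximal; move=> [mL maxL].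
by apply/seteqP; split; [exact: maxD | exact: maxL].
Qed.

End Simplex.

Arguments simplex R {n} alpha.

Section Cones.
Variables (R : realType) (n : nat).
Implicit Types (f p : {mpoly R[n]}) (d : nat).

(* msize is the degree plus one (and msize 0 = 0). *)
Definition deg_le d p : Prop := (msize p <= d.+1)%N.

Definition Psd d f : Prop :=
  deg_le (2 * d) f /\ forall x : 'I_n -> R, 0 <= f.@[x].

Definition Sos d f : Prop :=
  exists2 s : seq {mpoly R[n]},
    (forall p, p \in s -> deg_le d p) & f = \sum_(p <- s) p ^+ 2.

Definition sum_binomial_squares f : Prop :=
  exists2 s : seq {mpoly R[n]},
    (forall p, p \in s -> (size (msupp p) <= 2)%N) & f = \sum_(p <- s) p ^+ 2.

Definition P_Delta (alpha : 'I_n -> 'X_{1..n}) (y : 'X_{1..n}) f : Prop :=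
  exists (b0 : R) (b : 'I_n -> R) (c : R),
    [/\ 0 < b0, forall j, 0 < b j, c != 0 &
      f = b0%:MP + \sum_(j < n) b j *: 'X_[alpha j] + c *: 'X_[y]].

Definition Psd_Delta d alpha y f : Prop := Psd d f /\ P_Delta alpha y f.

Definition Sos_Delta d alpha y f : Prop := Sos d f /\ P_Delta alpha y f.

End Cones.

(* Main.v *)
Require Import Defs.
From mathcomp Require Import all_boot all_order all_algebra.
From mathcomp Require Import mpoly.
From mathcomp Require Import boolp classical_sets reals topology normedtype.
From mathcomp Require Import sequences exp ring lra zify.

Set Implicit Arguments.
Unset Strict Implicit.
Unset Printing Implicit Defensive.

Import Order.TTheory GRing.Theory Num.Theory numFieldNormedType.Exports.

Local Open Scope classical_set_scope.
Local Open Scope ring_scope.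

(** Let E = conv {0, alpha(1), ..., alpha(n)}, and let bary m be the coordinates of
an exponent m in the basis alpha(1), ..., alpha(n).

Necessity.  Let f be the sum of the squares of the polynomials p in s.  By
[sum_sqr_support_weight], a linear form bounded by 2M on the exponents of f is
bounded by M on the exponents of each p, for the extreme exponents of the p cannot
cancel in f.  The barycentric coordinates are linear forms cutting out E, so
2 supp p lies in E.  Let L consist of the vertices, of y, and of all the 2m with m
in some supp p.  If z = 2m in L is neither a vertex nor the sum of two distinct
exponents of one p, then the coefficient of x^z in f is a sum of squares in which
the square of p_m is nonzero, hence it is positive; but off the vertices the only
coefficient of f is c at y, which is not positive if y is even and the second
alternative fails.  So z = u + v with u <> v, that is, z is the midpoint of the
points 2u and 2v of L.  The point y is treated in the same way, its coefficient
being nonzero.  Hence L is mediated ([sos_mediated]).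

Sufficiency.  Choose tau > 0 such that the monomials
e(m) = tau^m x^m satisfy b_j x^alpha(j) = lambda_j e(alpha(j)); this is a linear
system for the logarithms of tau.  Put N(m) = sum of (bary m)_j e(alpha(j)),
the vertex 0 included, and f = N(y) + c' e(y).  At the point 1 / tau every e(m) is
1, so f >= 0 gives c' >= -1; if y has an odd entry, a sign change there gives
c' <= 1.  So unless c > 0 and y is even, f is a convex combination of N(y), which is
a sum of monomial squares, and N(y) - e(y) or N(y) + e(y), the latter only if y is
not even.  If z is the midpoint of even points s and t, then the agiforms
g(z) = N(z) - e(z) satisfy
  g(z) = 1/2 g(s) + 1/2 g(t) + 1/2 (e(s/2) - e(t/2))^2.
In a mediated set every point is a vertex, where g vanishes, or such a midpoint.
These relations may be circular, but as the squared norm is strictly convex they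
form a strictly dominant linear system, which can be solved within the cone of sums
of binomial squares by elimination ([cone_elimination]).  The case of + e(y) only
needs one more such relation, with the sign in the square changed.

The bound d on the degrees in a sum of squares is again an instance of
[sum_sqr_support_weight], for the total degree. *)

(** * Coefficients of sums of squares *)

(** Only cross terms can give a square a negative coefficient, or a nonzero one at an
exponent outside 2 supp p. *)
Lemma sqr_mcoeff_no_cross (R : idomainType) (n : nat) (p : {mpoly R[n]})
    (z : 'X_{1..n}) :
  (forall u v, u \in msupp p -> v \in msupp p -> (u + v)%MM = z -> u = v) ->
  (forall m, z = (m + m)%MM -> (p ^+ 2)@_z = p@_m ^+ 2) /\
  ((forall m, m \in msupp p -> z <> (m + m)%MM) -> (p ^+ 2)@_z = 0).
Proof.
move=> nocross; rewrite expr2 mcoeffM.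
have vanish (k : 'X_{1..n < (mdeg z).+1, (mdeg z).+1}) :
    z == (k.1 + k.2)%MM -> (k.1 : 'X_{1..n}) <> k.2 -> p@_k.1 * p@_k.2 = 0.
  move=> /eqP zE kk; apply/eqP; rewrite mulf_eq0 !mcoeff_eq0 -negb_and.
  by apply/negP => /andP[k1 k2]; apply: kk; apply: nocross.
split=> [m zE|nodouble].
- have mlt : (mdeg m < (mdeg z).+1)%N by rewrite zE mdegD ltnS leq_addr.
  rewrite (bigD1 (BMultinom mlt, BMultinom mlt)) /=; last by apply/eqP.
  rewrite big1 ?addr0 ?expr2// => -[k1 k2] /= /andP[zk kN].
  apply: (vanish (k1, k2)) => /=; first by rewrite zk.
  move=> k12; move/eqP: kN; apply; move/eqP/mnmP: zk => zk.
  move/mnmP: zE => zE.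
  have k1m : k1 = BMultinom mlt.
    apply/val_inj/mnmP => i /=; have := zk i; rewrite zE !mnmDE.
    by have := congr1 (fun M : 'X_{1..n} => M i) k12; lia.
  by rewrite -k1m; congr (_, _); apply/val_inj.
- rewrite big1// => k zk; have [k12|/eqP] := eqVneq (k.1 : 'X_{1..n}) k.2.
    have [k1s|/memN_msupp_eq0 ->] := boolP ((k.1 : 'X_{1..n}) \in msupp p).
      by case: (nodouble _ k1s); rewrite {2}k12; apply/eqP.
    by rewrite mul0r.
  exact: vanish.
Qed.

Lemma total_greatest (I : eqType) (r : rel I) (s : seq I) (x0 : I) :
  total r -> transitive r -> x0 \in s ->
  exists2 x, x \in s & {in s, forall z, r z x}.
Proof.
move=> tot tr; elim: s x0 => // a [|b s] IH x0 _.
  exists a; rewrite ?mem_head// => z; rewrite inE => /eqP ->.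
  by case/orP: (tot a a).
have [x xs xmax] := IH b (mem_head _ _).
case/orP: (tot a x) => ax.
  exists x; first by rewrite inE xs orbT.
  by move=> z; rewrite inE => /orP[/eqP ->//|/xmax].
exists a; first exact: mem_head.
move=> z; rewrite inE => /orP[/eqP ->|/xmax zx]; last exact: tr ax.
by case/orP: (tot a a).
Qed.

(** Among the exponents of all the p, take one, t, that maximises first w and then the
monomial order.  Then t + t has no other decomposition into two exponents of one p,
so its coefficient in the sum of squares is a sum of squares of the p_t and does not
vanish; the bound at t + t then bounds w t, hence w. *)
Lemma sum_sqr_support_weight (R : realDomainType) (n : nat)
    (s : seq {mpoly R[n]}) (w : 'X_{1..n} -> R) (M : R) :
  (forall u v, w (u + v)%MM = w u + w v) ->
  (forall z, z \in msupp (\sum_(p <- s) p ^+ 2) -> w z <= M *+ 2) ->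
  forall p m, p \in s -> m \in msupp p -> w m <= M.
Proof.
move=> wD wM p m ps mp.
(* A linear form need not be injective on exponents; the monomial order breaks
   ties, so that the maximum t is an extreme point and not merely on a face. *)
pose r u v := (w u < w v) || (w u == w v) && (u <= v)%O.
have rtot : total r.
  move=> u v; rewrite /r; case: ltgtP => //= _; exact: le_total.
have rtr : transitive r.
  move=> v u t; rewrite /r => /orP[uv|/andP[/eqP -> uv]] /orP[vt|/andP[/eqP <- vt]].
  - by rewrite (lt_trans uv vt).
  - by rewrite uv.
  - by rewrite vt.
  - by rewrite eqxx (le_trans uv vt) orbT.
have mU : m \in flatten [seq msupp q | q <- s].
  by apply/flatten_mapP; exists p.
have [t /flatten_mapP[q qs tq] tmax] := total_greatest rtot rtr mU.
have wmt : w m <= w t.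
  by case/orP: (tmax _ mU) => [/ltW//|/andP[/eqP ->]].
apply: (le_trans wmt); rewrite -(ler_pMn2r (ltn0Sn 1)) mulr2n -wD; apply: wM.
have coefE q' : q' \in s -> (q' ^+ 2)@_(t + t) = q'@_t ^+ 2.
  move=> q's; apply: (proj1 (@sqr_mcoeff_no_cross _ _ q' (t + t)%MM _)) => //.
  move=> u v uq vq uv.
  have ut : r u t by apply: tmax; apply/flatten_mapP; exists q'.
  have vt : r v t by apply: tmax; apply/flatten_mapP; exists q'.
  have wuv : w u + w v = w t + w t by rewrite -!wD uv.
  have wle a : r a t -> w a <= w t by case/orP => [/ltW|/andP[/eqP ->]].
  have wu : w u = w t.
    by apply/eqP; rewrite eq_le wle//= -(lerD2r (w v)) wuv lerD2l wle.
  have wv : w v = w t by move/eqP: wuv; rewrite wu (inj_eq (addrI _)) => /eqP.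
  move: ut vt; rewrite /r wu wv ltxx eqxx /= => ut vt.
  case: (ltgtP u t) ut => // [ut _|ut _]; last first.
    by apply/mnmP => i; move/mnmP: uv => /(_ i); rewrite ut !mnmDE; lia.
  by have := ltmc_le_add ut vt; rewrite uv ltxx.
rewrite mcoeff_msupp raddf_sum/= big_seq (eq_bigr _ coefE) -big_seq.
rewrite psumr_neq0 => [|q' _]; last exact: sqr_ge0.
apply/hasP; exists q => //=; rewrite exprn_even_gt0//= -?mcoeff_msupp//.
Qed.

(** * Exponents and barycentric coordinates *)

Section Coordinates.
Variables (R : realType) (n : nat) (alpha : 'I_n -> 'X_{1..n}).

Local Notation pt m := (real_pt R (mnm_pt m)).

Lemma mnm_ptD (u v : 'X_{1..n}) : mnm_pt (u + v)%MM = mnm_pt u + mnm_pt v.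
Proof. by apply/rowP => i; rewrite !mxE mnmDE PoszD. Qed.

Lemma mnm_pt_inj : injective (@mnm_pt n).
Proof. by move=> u v /rowP uv; apply/mnmP => i; have := uv i; rewrite !mxE => -[]. Qed.

Lemma even_mnm_pt (m : 'X_{1..n}) : even_pt (mnm_pt m) <-> even_mnm m.
Proof.
by split=> em i; have := em i; rewrite mxE -dvdn2 /dvdz.
Qed.

Lemma even_mnm_double (m : 'X_{1..n}) :
  even_mnm m -> m = ([multinom (m i)./2 | i < n] + [multinom (m i)./2 | i < n])%MM.
Proof.
move=> em; apply/mnmP => i; rewrite mnmDE !mnmE addnn.
by rewrite -[LHS]odd_double_half (negbTE (em i)).
Qed.

Lemma double_even_mnm (m : 'X_{1..n}) : even_mnm (m + m)%MM.
Proof. by move=> i; rewrite mnmDE addnn odd_double. Qed.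

Lemma real_mnm_ptE (m : 'X_{1..n}) i : pt m 0 i = (m i)%:R.
Proof. by rewrite !mxE. Qed.

Lemma real_mnm_ptD (u v : 'X_{1..n}) : pt (u + v)%MM = pt u + pt v.
Proof. by apply/rowP => i; rewrite !mxE mnmDE PoszD intrD. Qed.

Definition vertex_mx : 'M[R]_n := \matrix_(j < n) pt (alpha j).

Definition bary (m : 'X_{1..n}) : 'rV[R]_n := pt m *m invmx vertex_mx.

Lemma real_vertex0 : real_pt R (vertex alpha ord0) = 0.
Proof. by rewrite /vertex unlift_none; apply/rowP => i; rewrite !mxE. Qed.

Lemma vertex_lift j : vertex alpha (lift ord0 j) = mnm_pt (alpha j).
Proof. by rewrite /vertex liftK. Qed.

(** As the first vertex is the origin, affine independence of the vertices is
linear independence of the alpha j. *)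
Lemma vertex_mx_unit : even_simplex R alpha -> vertex_mx \in unitmx.
Proof.
case=> indep _; rewrite -row_free_unit.
have <- : \matrix_(i < n) (real_pt R (vertex alpha (lift ord0 i))
    - real_pt R (vertex alpha ord0)) = vertex_mx.
  by apply/row_matrixP => i; rewrite !rowK vertex_lift real_vertex0 subr0.
exact: indep.
Qed.

Lemma simplexE z : simplex R alpha z <->
  exists w : 'I_n -> R, [/\ forall j, 0 <= w j, \sum_j w j <= 1
    & z = \sum_j w j *: pt (alpha j)].
Proof.
split=> [[w [w0 w1 ->]]|[w [w0 w1 ->]]].
  exists (fun j => w (lift ord0 j)); split=> //.
    by rewrite -w1 big_ord_recl lerDr.
  rewrite big_ord_recl real_vertex0 scaler0 add0r.
  by apply: eq_bigr => j _; rewrite vertex_lift.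
exists (fun i => if unlift ord0 i is Some j then w j else 1 - \sum_j w j).
split=> [i||].
- by case: unliftP => [j _|_]; rewrite ?subr_ge0.
- rewrite big_ord_recl unlift_none [X in _ + X](eq_bigr w) ?subrK// => j _.
  by rewrite liftK.
- rewrite big_ord_recl unlift_none real_vertex0 scaler0 add0r.
  by apply: eq_bigr => j _; rewrite vertex_lift liftK.
Qed.

Lemma baryD u v j : bary (u + v)%MM 0 j = bary u 0 j + bary v 0 j.
Proof. by rewrite /bary real_mnm_ptD mulmxDl mxE. Qed.

Lemma bary0 j : bary 0%MM 0 j = 0.
Proof.
have pt0 : pt (0%MM : 'X_{1..n}) = 0 by apply/rowP => i; rewrite !mxE mnm0E.
by rewrite /bary pt0 mul0mx mxE.
Qed.

Hypothesis A_unit : vertex_mx \in unitmx.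

Lemma bary_unique (w : 'I_n -> R) m :
  pt m = \sum_j w j *: pt (alpha j) -> forall j, bary m 0 j = w j.
Proof.
move=> mE j; rewrite /bary mE.
have -> : \sum_j w j *: pt (alpha j) = (\row_j w j) *m vertex_mx.
  rewrite mulmx_sum_row; apply: eq_bigr => k _.
  by rewrite rowK mxE.
by rewrite mulmxK// mxE.
Qed.

Lemma bary_decomposition m : pt m = \sum_j bary m 0 j *: pt (alpha j).
Proof.
rewrite -[LHS](mulmxKV A_unit) -/(bary m) mulmx_sum_row.
by apply: eq_bigr => j _; rewrite rowK.
Qed.

Lemma bary_vertex k j : bary (alpha k) 0 j = (k == j)%:R.
Proof.
apply: (bary_unique (w := fun j => (k == j)%:R)).
rewrite (bigD1 k)//= eqxx scale1r big1 ?addr0// => i /negPf ki.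
by rewrite eq_sym ki scale0r.
Qed.

Lemma bary_in_simplex m :
  (forall j, 0 <= bary m 0 j) -> \sum_j bary m 0 j <= 1 -> simplex R alpha (pt m).
Proof.
move=> m0 m1; apply/simplexE; exists (fun j => bary m 0 j).
by split=> //; exact: bary_decomposition.
Qed.

End Coordinates.

Lemma verticesP (n : nat) (alpha : 'I_n -> 'X_{1..n}) (m : 'X_{1..n}) :
  vertices alpha (mnm_pt m) <-> m = 0%MM \/ exists j, m = alpha j.
Proof.
have pt0 : mnm_pt 0%MM = 0 :> 'rV[int]_n.
  by apply/rowP => i; rewrite !mxE mnm0E.
split=> [[j _]|[->|[j ->]]].
- rewrite /vertex; case: unliftP => [k _ /mnm_pt_inj <-|_]; first by right; exists k.
  by rewrite -pt0 => /mnm_pt_inj <-; left.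
- by exists ord0 => //; rewrite /vertex unlift_none pt0.
- by exists (lift ord0 j) => //; rewrite vertex_lift.
Qed.

(** * Necessity *)

Section Necessity.
Variables (R : realType) (n : nat) (alpha : 'I_n -> 'X_{1..n}) (y : 'X_{1..n}).
Variables (b0 : R) (b : 'I_n -> R) (c : R).

Let f : {mpoly R[n]} := b0%:MP + \sum_(j < n) b j *: 'X_[alpha j] + c *: 'X_[y].

Lemma circuit_mcoeff z : ~ vertices alpha (mnm_pt z) -> f@_z = c *+ (y == z).
Proof.
move=> /verticesP zV.
rewrite !mcoeffD mcoeffC raddf_sum mcoeffZ mcoeffX /=.
have /negPf -> : z != 0%MM by apply/eqP => z0; apply: zV; left.
rewrite mulr0 add0r big1 ?add0r ?mulr_natr// => j _.
rewrite mcoeffZ mcoeffX; case: eqP => [jz|_]; last by rewrite mulr0.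
by case: zV; right; exists j.
Qed.

Lemma circuit_support z : z \in msupp f -> z = y \/ vertices alpha (mnm_pt z).
Proof.
have [zV|zV] := pselect (vertices alpha (mnm_pt z)); first by right.
rewrite mcoeff_msupp circuit_mcoeff//; have [->|_] := eqVneq y z; first by left.
by rewrite eqxx.
Qed.

Variable s : seq {mpoly R[n]}.
Hypothesis fE : f = \sum_(p <- s) p ^+ 2.
Hypothesis A_unit : vertex_mx R alpha \in unitmx.
Hypothesis y_ge0 : forall j, 0 <= bary R alpha y 0 j.
Hypothesis y_le1 : \sum_j bary R alpha y 0 j <= 1.

(** The simplex is cut out by the n + 1 linear forms -bary _ j and sum_j bary _ j,
whose bounds 0 and 1 on the support of f pass to the supports of the p. *)
Lemma sos_support_in_simplex p m : p \in s -> m \in msupp p ->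
  simplex R alpha (real_pt R (mnm_pt (m + m)%MM)).
Proof.
move=> ps mp; apply: bary_in_simplex => // [j|].
- have : - bary R alpha m 0 j <= 0.
    apply: (sum_sqr_support_weight (w := fun m => - bary R alpha m 0 j) _ _ ps mp).
      by move=> u v; rewrite baryD opprD.
    move=> z; rewrite mul0rn oppr_le0 -fE => /circuit_support[->//|/verticesP].
    move=> [->|[k ->]]; last by rewrite bary_vertex// ler0n.
    by rewrite bary0.
  by rewrite oppr_le0 baryD => m0; apply: addr_ge0.
- suff : \sum_j bary R alpha m 0 j <= 2^-1.
    move=> m1; rewrite (eq_bigr (fun j => bary R alpha m 0 j + bary R alpha m 0 j)).
      by rewrite big_split/=; lra.
    by move=> j _; rewrite baryD.
  apply: (sum_sqr_support_weight (w := fun m => \sum_j bary R alpha m 0 j) _ _ ps mp).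
    by move=> u v; rewrite -big_split; apply: eq_bigr => j _; rewrite baryD.
  have half2 : 2^-1 *+ 2 = 1 :> R by rewrite -[_ *+ 2]mulr_natr mulVf ?pnatr_eq0.
  move=> z; rewrite half2 -fE => /circuit_support[->//|/verticesP].
  move=> [->|[k ->]].
    by rewrite big1 ?ler01// => j _; rewrite bary0.
  rewrite (bigD1 k)//= bary_vertex// eqxx big1 ?addr0// => j jk.
  by rewrite bary_vertex// eq_sym (negPf jk).
Qed.

Hypothesis c_neq0 : c != 0.

(** The doubled exponents of the p, together with y and the vertices, form a mediated
set: at a point without two distinct summands in one supp p, the coefficient of f
would have a sign or a vanishing that contradicts the shape of f. *)
Lemma sos_mediated : ~ (0 < c /\ even_mnm y) -> Delta_star R alpha (mnm_pt y).
Proof.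
move=> cy.
pose H : set 'X_{1..n} := [set m | exists2 p, p \in s & m \in msupp p].
pose L : set 'rV[int]_n := vertices alpha `|` [set mnm_pt y]
  `|` [set mnm_pt (m + m)%MM | m in H].
have Hcross z : (z = y \/ exists2 m, H m & z = (m + m)%MM) ->
    ~ vertices alpha (mnm_pt z) ->
    exists u v, [/\ H u, H v, u <> v & (u + v)%MM = z].
  move=> zyH zV; apply: contrapT => nocross.
  have nc p : p \in s -> forall u v, u \in msupp p -> v \in msupp p ->
      (u + v)%MM = z -> u = v.
    move=> ps u v up vp uv; apply: contrapT => uv'; apply: nocross.
    by exists u, v; split=> //; exists p.
  have fz : f@_z = \sum_(p <- s) (p ^+ 2)@_z by rewrite fE raddf_sum.
  have fz_dbl m : H m -> z = (m + m)%MM -> False.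
    move=> [p ps mp] zm.
    have : 0 < f@_z.
      rewrite fz big_seq; under eq_bigr => q qs do
        rewrite (proj1 (sqr_mcoeff_no_cross (nc q qs)) _ zm).
      rewrite -big_seq lt_def sumr_ge0 => [|q _]; last exact: sqr_ge0.
      rewrite andbT psumr_neq0 => [|q _]; last exact: sqr_ge0.
      by apply/hasP; exists p => //=; rewrite exprn_even_gt0//= -mcoeff_msupp.
    rewrite circuit_mcoeff//; case: eqP => [yz|_]; last by rewrite ltxx.
    by move=> c0; apply: cy; rewrite yz zm; split=> //; exact: double_even_mnm.
  case: zyH => [zy|[m]]; last exact: fz_dbl.
  have : f@_z != 0 by rewrite circuit_mcoeff// zy eqxx.
  rewrite fz big_seq big1 ?eqxx// => p ps.
  apply: (proj2 (sqr_mcoeff_no_cross (nc p ps))) => m mp.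
  by apply: fz_dbl; exists p.
exists L; last by left; right.
split=> [z|z Vz|z].
- move=> [[Vz|->]|[m [p ps mp] <-]] /=.
  + by have [sV _ _] := vertices_mediated R alpha; exact: sV.
  + exact: bary_in_simplex.
  + exact: sos_support_in_simplex ps mp.
- by left; left.
- move=> Lz; have [Vz|Vz] := pselect (vertices alpha z); [by right|left].
  have [m mz mH] : exists2 m, z = mnm_pt m &
      (m = y \/ exists2 u, H u & m = (u + u)%MM).
    move: Lz => [[//|->]|[u Hu <-]]; first by exists y => //; left.
    by exists (u + u)%MM => //; right; exists u.
  rewrite mz in Vz *; have [u [v [Hu Hv uv uvm]]] := Hcross m mH Vz.
  exists (mnm_pt (u + u)%MM), (mnm_pt (v + v)%MM); split.
  + move=> /mnm_pt_inj/mnmP uuvv; apply: uv; apply/mnmP => i.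
    by have := uuvv i; rewrite !mnmDE; lia.
  + by split; [right; exists u | apply/even_mnm_pt/double_even_mnm].
  + by split; [right; exists v | apply/even_mnm_pt/double_even_mnm].
  + by rewrite -uvm !mnm_ptD addrACA.
Qed.

End Necessity.

(** * Elimination in a convex cone *)

Section ConeElimination.
Variables (R : realFieldType) (V : lmodType R) (K : V -> Prop).
Hypothesis KD : forall x y, K x -> K y -> K (x + y).
Hypothesis KZ : forall a x, 0 <= a -> K x -> K (a *: x).

(** Modulo K, the vector g satisfies g >= P g entrywise, with a nonnegative matrix P
such that P u < u for a positive vector u.  Then 1 - P has a nonnegative inverse, so
that g >= 0.  The proof is Gaussian elimination: the condition on u gives
P a a < 1, so that g a can be eliminated, and the condition survives for the
remaining indices. *)
Lemma cone_elimination (I : eqType) (E : seq I) (u : I -> R) (g : I -> V) :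
  (forall z, z \in E -> 0 < u z) ->
  (forall z, z \in E -> exists p : I -> R,
    [/\ forall w, 0 <= p w, \sum_(w <- E) p w * u w < u z
      & K (g z - \sum_(w <- E) p w *: g w)]) ->
  forall z, z \in E -> K (g z).
Proof.
elim: E => // a E IH u_gt0 red.
have [pa [pa0 pau Ka]] := red a (mem_head _ _).
rewrite !big_cons in pau Ka.
have ua0 : 0 < u a by apply: u_gt0; exact: mem_head.
have rest0 : 0 <= \sum_(w <- E) pa w * u w.
  by rewrite big_seq sumr_ge0// => w wE; rewrite mulr_ge0// ltW// u_gt0// inE wE orbT.
have pa1 : 0 < 1 - pa a.
  by rewrite subr_gt0 -(ltr_pM2r ua0) mul1r; apply: le_lt_trans pau; rewrite lerDl.
(* The row of a, solved for g a. *)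
pose q w := (1 - pa a)^-1 * pa w.
have q0 w : 0 <= q w by rewrite mulr_ge0// invr_ge0 ltW.
have qu : \sum_(w <- E) q w * u w < u a.
  rewrite (eq_bigr (fun w => (1 - pa a)^-1 * (pa w * u w))) => [|w _]; last first.
    by rewrite mulrA.
  rewrite -mulr_sumr mulrC ltr_pdivrMr//.
  by move: pau; rewrite mulrBr mulr1 ltrBrDr addrC mulrC [u a * _]mulrC.
have Kq : K (g a - \sum_(w <- E) q w *: g w).
  have := KZ (a := (1 - pa a)^-1) _ Ka; rewrite invr_ge0 ltW// => /(_ isT).
  have -> : \sum_(w <- E) q w *: g w = (1 - pa a)^-1 *: \sum_(w <- E) pa w *: g w.
    by rewrite scaler_sumr; apply: eq_bigr => w _; rewrite scalerA.
  rewrite opprD addrA scalerBr -[X in X - pa a *: _]scale1r -scalerBl scalerA.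
  by rewrite mulVf ?gt_eqF// scale1r.
have KE z : z \in E -> K (g z).
  apply: IH => [z' z'E|{}z zE]; first by apply: u_gt0; rewrite inE z'E orbT.
  have [|p [p0 pu Kz]] := red z; first by rewrite inE zE orbT.
  rewrite !big_cons in pu Kz.
  exists (fun w => p w + p a * q w); split=> [w||].
  - by rewrite addr_ge0// mulr_ge0.
  - rewrite (eq_bigr (fun w => p w * u w + p a * (q w * u w))) => [|w _]; last first.
      by rewrite mulrDl -mulrA.
    rewrite big_split/= -mulr_sumr addrC; apply: le_lt_trans pu.
    by rewrite lerD2r ler_wpM2l// ltW.
  - have -> : \sum_(w <- E) (p w + p a * q w) *: g w =
        \sum_(w <- E) p w *: g w + p a *: \sum_(w <- E) q w *: g w.
      rewrite scaler_sumr -big_split/=.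
      by apply: eq_bigr => w _; rewrite scalerDl scalerA.
    rewrite opprD addrA -(subrKA (p a *: g a)) -scalerBr.
    by rewrite -(addrA (g z)) -opprD [X in g z - X]addrC; exact: KD Kz (KZ (p0 a) Kq).
move=> z; rewrite inE => /orP[/eqP ->|]; last exact: KE.
rewrite -[g a](subrK (\sum_(w <- E) q w *: g w)); apply: KD => //.
rewrite big_seq; apply: (big_ind K) => [||w wE]; last by apply: KZ => //; exact: KE.
- by rewrite -(scale0r (g a - \sum_(w <- E) q w *: g w)); apply: KZ.
- exact: KD.
Qed.

End ConeElimination.

(** * The cone of sums of binomial squares (sbs) *)

Section BinomialSquares.
Variables (R : realType) (n : nat).
Implicit Types f g : {mpoly R[n]}.

Lemma sbs0 : sum_binomial_squares (0 : {mpoly R[n]}).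
Proof. by exists [::] => //; rewrite big_nil. Qed.

Lemma sbsD f g : sum_binomial_squares f -> sum_binomial_squares g ->
  sum_binomial_squares (f + g).
Proof.
move=> [s sP ->] [t tP ->]; exists (s ++ t); last by rewrite big_cat.
by move=> p; rewrite mem_cat => /orP[/sP|/tP].
Qed.

Lemma sbs_sum (I : Type) (r : seq I) (F : I -> {mpoly R[n]}) :
  (forall i, sum_binomial_squares (F i)) ->
  sum_binomial_squares (\sum_(i <- r) F i).
Proof. by move=> FP; apply: big_ind => //; [exact: sbs0 | exact: sbsD]. Qed.

Lemma sbsZ a f : 0 <= a -> sum_binomial_squares f -> sum_binomial_squares (a *: f).
Proof.
move=> a0 [s sP ->]; exists [seq Num.sqrt a *: p | p <- s].
  move=> _ /mapP[p ps ->]; apply: leq_trans (sP p ps).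
  by apply: uniq_leq_size; [exact: msupp_uniq | exact: msuppZ_le].
rewrite big_map scaler_sumr; apply: eq_bigr => p _.
by rewrite exprZn sqr_sqrtr.
Qed.

Lemma sbs_binomial (a b : R) (u v : 'X_{1..n}) :
  sum_binomial_squares ((a *: 'X_[u] + b *: 'X_[v]) ^+ 2).
Proof.
exists [:: a *: 'X_[u] + b *: 'X_[v]]; last by rewrite big_seq1.
move=> p; rewrite inE => /eqP ->.
apply: (@leq_trans (size [:: u; v])) => //.
apply: uniq_leq_size => [|m]; first exact: msupp_uniq.
move=> /msuppD_le; rewrite mem_cat => /orP[] /msuppZ_le; rewrite msuppX !inE => /eqP ->.
  by rewrite eqxx.
by rewrite eqxx orbT.
Qed.

(** The degree bound on the summands comes for free, as leading forms of squares do
not cancel. *)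
Lemma sbs_Sos d f : deg_le (2 * d) f -> sum_binomial_squares f -> Sos d f.
Proof.
move=> fd [s _ fE]; exists s => // p ps.
rewrite /deg_le msizeE; apply/bigmax_leqP_seq => m mp _; rewrite ltnS.
rewrite -(ler_nat R).
apply: (sum_sqr_support_weight (w := fun m => (mdeg m)%:R) _ _ ps mp) => [u v|z].
  by rewrite mdegD natrD.
rewrite -fE => /msize_mdeg_lt zf; rewrite -[_ *+ 2]mulr_natr -natrM ler_nat.
by rewrite mulnC -ltnS; exact: leq_trans fd.
Qed.

End BinomialSquares.

(** * Agiforms with exponents in a mediated set *)

Section LatticePointsOfSimplex.
Variables (R : realType) (n : nat) (alpha : 'I_n -> 'X_{1..n}).

(** Lattice points of the simplex are exponents, and there are finitely many of
them: a mediated set is therefore amenable to elimination. *)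
Lemma simplex_lattice_point (z : 'rV[int]_n) : simplex R alpha (real_pt R z) ->
  exists2 m, z = mnm_pt m & (mdeg m <= \sum_j mdeg (alpha j))%N.
Proof.
move=> /simplexE[w [w0 w1 zE]].
have ziE i : (z 0 i)%:~R = \sum_j w j * (alpha j i)%:R :> R.
  have /rowP/(_ i) := zE; rewrite mxE => ->; rewrite summxE.
  by apply: eq_bigr => j _; rewrite mxE real_mnm_ptE.
have zi0 i : 0 <= z 0 i.
  by rewrite -(ler0z R) ziE sumr_ge0// => j _; rewrite mulr_ge0// ler0n.
pose m := [multinom absz (z ord0 i) | i < n].
have mi i : (m i)%:Z = z 0 i by rewrite mnmE gez0_abs.
exists m; first by apply/rowP => i; rewrite mxE mi.
have wle1 j : w j <= 1.
  apply: le_trans w1; rewrite (bigD1 j)//= lerDl.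
  by apply: sumr_ge0.
have mile i : (m i <= \sum_j alpha j i)%N.
  rewrite -(ler_nat R) -[X in X <= _]/((m i)%:Z%:~R) mi ziE natr_sum.
  by apply: ler_sum => j _; rewrite ler_piMl// ler0n.
under eq_bigr do rewrite mdegE.
by rewrite mdegE exchange_big; apply: leq_sum => i _; exact: mile.
Qed.

End LatticePointsOfSimplex.

Definition mnm_sqnorm (R : realType) n (m : 'X_{1..n}) : R := \sum_i (m i)%:R ^+ 2.

(** Strict convexity; the difference of the two sides is |s - t|^2 / 4. *)
Lemma mnm_sqnorm_midpoint (R : realType) n (z s t : 'X_{1..n}) :
  s <> t -> (z + z)%MM = (s + t)%MM ->
  2^-1 * mnm_sqnorm R s + 2^-1 * mnm_sqnorm R t > mnm_sqnorm R z.
Proof.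
move=> st /mnmP zE; rewrite !mulr_sumr -big_split/= -subr_gt0 -sumrB.
have termE i : 2^-1 * (s i)%:R ^+ 2 + 2^-1 * (t i)%:R ^+ 2 - (z i)%:R ^+ 2 =
    (2^-1 * ((s i)%:R - (t i)%:R)) ^+ 2 :> R.
  have /(congr1 (fun k : nat => k%:R : R)) := zE i; rewrite !mnmDE !natrD => zi.
  have -> : (z i)%:R = 2^-1 * ((s i)%:R + (t i)%:R) :> R.
    by rewrite -zi; field.
  by field.
rewrite (eq_bigr _ (fun i _ => termE i)) lt_def.
rewrite sumr_ge0 ?andbT => [|i _]; last exact: sqr_ge0.
rewrite psumr_neq0 => [|i _]; last exact: sqr_ge0.
apply: contra_notT st => /hasPn st; apply/mnmP => i; apply/eqP.
have := st i (mem_index_enum i); rewrite -leNgt real_exprn_even_le0 ?num_real//=.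
by rewrite mulf_eq0 invr_eq0 pnatr_eq0/= subr_eq0 eqr_nat.
Qed.

Section MediatedAgiform.
Variables (R : realType) (n : nat) (alpha : 'I_n -> 'X_{1..n}).
Variable tau : 'I_n -> R.
Hypothesis A_unit : vertex_mx R alpha \in unitmx.

Definition scaled_mon (m : 'X_{1..n}) : {mpoly R[n]} := 'X_[m].@[tau] *: 'X_[m].

Lemma scaled_monD u v : scaled_mon (u + v)%MM = scaled_mon u * scaled_mon v.
Proof. by rewrite /scaled_mon mpolyXD mevalM -scalerAl -scalerAr scalerA. Qed.

Lemma scaled_mon0 : scaled_mon 0%MM = 1.
Proof. by rewrite /scaled_mon mpolyX0 meval1 scale1r. Qed.

(** The combination of the monomials of the vertices whose exponents average to m;
for m in the simplex it dominates |scaled_mon m|, by the weighted AM-GM inequality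
for the even monomials of the vertices. *)
Definition simplex_interpolant (m : 'X_{1..n}) : {mpoly R[n]} :=
  (1 - \sum_j bary R alpha m 0 j)%:MP + \sum_j bary R alpha m 0 j *: scaled_mon (alpha j).

(** Reznick's name for the difference between an arithmetic and a geometric mean of
monomials. *)
Definition agiform (m : 'X_{1..n}) : {mpoly R[n]} := simplex_interpolant m - scaled_mon m.

Lemma simplex_interpolant_midpoint z s t : (z + z)%MM = (s + t)%MM ->
  simplex_interpolant z = 2^-1 *: simplex_interpolant s + 2^-1 *: simplex_interpolant t.
Proof.
move=> zE.
have bE j : bary R alpha z 0 j = 2^-1 * bary R alpha s 0 j + 2^-1 * bary R alpha t 0 j.
  have := baryD R alpha z z j; rewrite zE baryD => E.
  by rewrite -mulrDr E; field.
rewrite /simplex_interpolant !scalerDr addrACA; congr (_ + _).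
  rewrite -!mul_mpolyC -!mpolyCM -mpolyCD; congr (_%:MP).
  rewrite (eq_bigr _ (fun j _ => bE j)) big_split/= -!mulr_sumr.
  by field.
rewrite !scaler_sumr -big_split/=; apply: eq_bigr => j _.
by rewrite bE scalerDl -!scalerA.
Qed.

Lemma agiform_vertex m : vertices alpha (mnm_pt m) -> agiform m = 0.
Proof.
move=> /verticesP[->|[k ->]]; rewrite /agiform /simplex_interpolant.
  rewrite !big1 => [|j _|j _]; rewrite ?bary0 ?scale0r//.
  by rewrite subr0 addr0 scaled_mon0 mpolyC1 subrr.
rewrite (bigD1 k)//= (bigD1 k (F := fun j => _ *: _))//= !bary_vertex// eqxx.
rewrite !big1 => [|j jk|j jk];
  rewrite ?bary_vertex// ?[k == j]eq_sym ?(negPf jk) ?scale0r//.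
by rewrite !addr0 subrr scale1r mpolyC0 add0r subrr.
Qed.

(** The interpolant is affine in the exponent, so only the monomials contribute to the
difference, which is 1/2 (scaled_mon (s/2) + e scaled_mon (t/2))^2.  The sign
e = -1 serves agiforms, and e = 1 their variant with a positive last coefficient. *)
Lemma agiform_midpoint (e : R) z s t : e ^+ 2 = 1 ->
  even_mnm s -> even_mnm t -> (z + z)%MM = (s + t)%MM ->
  sum_binomial_squares (simplex_interpolant z + e *: scaled_mon z
    - (2^-1 *: agiform s + 2^-1 *: agiform t)).
Proof.
move=> e2 /even_mnm_double; set s2 := [multinom _ | _ < _] => sE.
move=> /even_mnm_double; set t2 := [multinom _ | _ < _] => tE zE.
have zst : z = (s2 + t2)%MM.
  apply/mnmP => i; move/mnmP: zE => /(_ i); rewrite sE tE !mnmDE; lia.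
have -> : simplex_interpolant z + e *: scaled_mon z
    - (2^-1 *: agiform s + 2^-1 *: agiform t) =
    2^-1 *: (scaled_mon s2 + e *: scaled_mon t2) ^+ 2.
  rewrite (simplex_interpolant_midpoint zE) /agiform zst sE tE !scaled_monD.
  have half2 : 2%:R * (2^-1)%:MP = 1 :> {mpoly R[n]}.
    by rewrite -mpolyC_nat -mpolyCM divff// pnatr_eq0.
  have e2' : e%:MP ^+ 2 = 1 :> {mpoly R[n]} by rewrite expr2 -mpolyCM -expr2 e2 mpolyC1.
  rewrite -!mul_mpolyC.
  move: (scaled_mon s2) (scaled_mon t2)
    (simplex_interpolant _) (simplex_interpolant _) => a b p q.
  transitivity ((2^-1)%:MP * (a * a) + ((2^-1)%:MP * e%:MP ^+ 2) * (b * b)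
    + (2%:R * (2^-1)%:MP) * e%:MP * (a * b)); last by ring.
  by rewrite e2' half2; ring.
apply: sbsZ; first by rewrite invr_ge0.
by rewrite /scaled_mon scalerA; exact: sbs_binomial.
Qed.

Variable L : set 'rV[int]_n.
Hypothesis L_mediated : mediated R alpha L.

Lemma mediated_midpoint z : L (mnm_pt z) -> ~ vertices alpha (mnm_pt z) ->
  exists s t, [/\ s <> t, L (mnm_pt s) /\ even_mnm s, L (mnm_pt t) /\ even_mnm t
    & (z + z)%MM = (s + t)%MM].
Proof.
have [Lsub _ Lmid] := L_mediated => Lz zV.
have [|//] := Lmid _ Lz => -[s [t [st [Ls es] [Lt et] zE]]].
have [s' sE _] := simplex_lattice_point (Lsub _ Ls).
have [t' tE _] := simplex_lattice_point (Lsub _ Lt).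
subst s t; exists s', t'; split.
- by move=> st'; apply: st; rewrite st'.
- by split=> //; apply/even_mnm_pt.
- by split=> //; apply/even_mnm_pt.
- by apply: mnm_pt_inj; rewrite !mnm_ptD.
Qed.

(** Elimination applied to the midpoint relations between the agiforms of the finitely
many points of L; at the vertices the agiforms vanish. *)
Lemma agiform_sbs z : L (mnm_pt z) -> sum_binomial_squares (agiform z).
Proof.
move=> Lz; have [Lsub _ _] := L_mediated.
pose D := (\sum_j mdeg (alpha j)).+1.
pose E : seq 'X_{1..n} :=
  [seq m <- [seq bmnm m | m <- enum {: 'X_{1..n < D}}] | `[< L (mnm_pt m) >]].
have Euniq : uniq E.
  apply: filter_uniq; rewrite map_inj_uniq ?enum_uniq//.
  by move=> u v /val_inj.
have EP m : (m \in E) <-> L (mnm_pt m).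
  rewrite mem_filter; split=> [/andP[/asboolP]//|Lm]; rewrite asboolT//=.
  have [m' /mnm_pt_inj <- mD] := simplex_lattice_point (Lsub _ Lm).
  have mD' : (mdeg m < D)%N by [].
  by apply/mapP; exists (BMultinom mD'); rewrite ?mem_enum.
(* The dominating vector: at a midpoint of two distinct points, a constant minus a
   strictly convex function exceeds the average of its values at these points. *)
pose u (m : 'X_{1..n}) : R := 1 + \sum_(w <- E) mnm_sqnorm R w - mnm_sqnorm R m.
have nrm0 (m : 'X_{1..n}) : 0 <= mnm_sqnorm R m.
  by apply: sumr_ge0 => i _; exact: sqr_ge0.
have u_gt0 m : m \in E -> 0 < u m.
  move=> mE; rewrite /u subr_gt0 (bigD1_seq m)//= addrCA ltrDl ltr_wpDr//.
  by apply: sumr_ge0.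
apply: (cone_elimination (@sbsD R n) (@sbsZ R n) u_gt0); last exact/EP.
move=> m /EP Lm; have [mV|mV] := pselect (vertices alpha (mnm_pt m)).
  exists (fun=> 0); split=> //.
    rewrite big1 => [|w _]; last by rewrite mul0r.
    exact/u_gt0/EP.
  by rewrite agiform_vertex// big1 ?subr0 => [|w _]; [exact: sbs0|rewrite scale0r].
have [s [t [st [Ls es] [Lt et] mst]]] := mediated_midpoint Lm mV.
have midsum (V : lmodType R) (F : 'X_{1..n} -> V) :
    \sum_(w <- E) (2^-1 * (w == s)%:R + 2^-1 * (w == t)%:R) *: F w =
    2^-1 *: F s + 2^-1 *: F t.
  have one a : a \in E -> \sum_(w <- E) (2^-1 * (w == a)%:R : R) *: F w = 2^-1 *: F a.
    move=> aE; rewrite (bigD1_seq a)//= eqxx mulr1 big1 ?addr0// => w /negPf ->.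
    by rewrite mulr0 scale0r.
  rewrite -(one s) ?(EP s).2// -(one t) ?(EP t).2// -big_split/=.
  by apply: eq_bigr => w _; rewrite scalerDl.
exists (fun w => 2^-1 * (w == s)%:R + 2^-1 * (w == t)%:R); split.
- by move=> w; rewrite addr_ge0// mulr_ge0// ?invr_ge0// ler0n.
- rewrite (midsum R^o u) /u /GRing.scale/=.
  have := mnm_sqnorm_midpoint R st mst.
  move: (\sum_(w <- E) _) (mnm_sqnorm R s) (mnm_sqnorm R t) (mnm_sqnorm R m) => S a b q.
  lra.
- rewrite midsum.
  have -> : agiform m = simplex_interpolant m + (-1) *: scaled_mon m by rewrite scaleN1r.
  by apply: agiform_midpoint => //; rewrite sqrrN expr1n.
Qed.

(** One midpoint relation with a positive sign reduces this to the agiforms of the two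
even points whose midpoint is z. *)
Lemma flipped_agiform_sbs z : L (mnm_pt z) -> ~ vertices alpha (mnm_pt z) ->
  sum_binomial_squares (simplex_interpolant z + scaled_mon z).
Proof.
move=> Lz zV; have [s [t [st [Ls es] [Lt et] mst]]] := mediated_midpoint Lz zV.
have := @agiform_midpoint 1 z s t (expr1n _ _) es et mst; rewrite scale1r => H.
rewrite -[X in sum_binomial_squares X](subrK (2^-1 *: agiform s + 2^-1 *: agiform t)).
apply: sbsD => //.
by apply: sbsD; apply: sbsZ; rewrite ?invr_ge0//; exact: agiform_sbs.
Qed.

End MediatedAgiform.

(** * Normalising the coefficients *)

Section Scaling.
Variables (R : realType) (n : nat) (alpha : 'I_n -> 'X_{1..n}).

(** Taking logarithms turns the equations into a linear system with matrix
vertex_mx. *)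
Lemma monomial_value_interpolation (v : 'I_n -> R) :
  vertex_mx R alpha \in unitmx -> (forall j, 0 < v j) ->
  exists2 tau : 'I_n -> R, (forall i, 0 < tau i) &
    forall j, 'X_[alpha j].@[tau] = v j.
Proof.
move=> A_unit v0; pose xi := invmx (vertex_mx R alpha) *m \col_j ln (v j).
exists (fun i => expR (xi i 0)) => [i|j]; first exact: expR_gt0.
have : (vertex_mx R alpha *m xi) j 0 = ln (v j) by rewrite mulKVmx// mxE.
rewrite mxE mevalX => xiE; rewrite -[RHS]lnK ?posrE// -xiE expR_sum.
by apply: eq_bigr => i _; rewrite [vertex_mx _ _ _ _]mxE real_mnm_ptE expRM_natl.
Qed.

Lemma even_monomial_eval1 (s : 'I_n -> R) (m : 'X_{1..n}) :
  (forall i, s i ^+ 2 = 1) -> even_mnm m -> 'X_[m].@[s] = 1.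
Proof.
move=> s2 em; rewrite mevalX big1// => i _.
by rewrite -[m i]odd_double_half (negbTE (em i)) add0n -muln2 mulnC exprM s2 expr1n.
Qed.

Lemma odd_monomial_sign (m : 'X_{1..n}) : ~ even_mnm m ->
  exists2 s : 'I_n -> R, (forall i, s i ^+ 2 = 1) & 'X_[m].@[s] = -1.
Proof.
move=> /existsNP[k /negP/negPn mk].
(* A single sign change, at an odd entry k of m. *)
exists (fun i => if i == k then -1 else 1) => [i|].
  by case: ifP; rewrite ?sqrrN expr1n.
rewrite mevalX (bigD1 k)//= eqxx big1 => [|i /negPf ->]; last by rewrite expr1n.
by rewrite mulr1 -signr_odd mk.
Qed.

End Scaling.

Section CircuitInequality.
Variables (R : realType) (n : nat) (alpha : 'I_n -> 'X_{1..n}) (y : 'X_{1..n}).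
Variables (tau : 'I_n -> R) (c : R).
Hypothesis tau_gt0 : forall i, 0 < tau i.
Hypothesis alpha_even : forall j, even_mnm (alpha j).

Let f := simplex_interpolant alpha tau y + c *: scaled_mon tau y.

(** At the points s / tau with s_i = +-1 the scaled monomials reduce to signs, and the
even ones to 1. *)
Lemma circuit_eval (s : 'I_n -> R) : (forall i, s i ^+ 2 = 1) ->
  f.@[fun i => s i / tau i] = 1 + c * 'X_[y].@[s].
Proof.
move=> s2.
have scaled_monE m : (scaled_mon tau m).@[fun i => s i / tau i] = 'X_[m].@[s].
  rewrite mevalZ !mevalX -big_split/=; apply: eq_bigr => i _.
  by rewrite -exprMn mulrCA divff ?mulr1// gt_eqF.
rewrite mevalD mevalZ scaled_monE; congr (_ + _).
rewrite mevalD mevalC [X in _ + X]raddf_sum/= -[RHS](subrK (\sum_j bary R alpha y 0 j)).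
congr (_ + _); apply: eq_bigr => j _.
by rewrite mevalZ scaled_monE even_monomial_eval1 ?mulr1.
Qed.

Hypothesis f_ge0 : forall x, 0 <= f.@[x].

Lemma circuit_coef_geN1 : -1 <= c.
Proof.
have := f_ge0 (fun i => 1 / tau i); rewrite (circuit_eval (s := fun=> 1)).
  by rewrite mevalX big1 => [|i _]; [lra | rewrite expr1n].
by move=> i; rewrite expr1n.
Qed.

Lemma circuit_coef_le1 : ~ even_mnm y -> c <= 1.
Proof.
move=> /(odd_monomial_sign R)[s s2 sy].
by have := f_ge0 (fun i => s i / tau i); rewrite circuit_eval// sy; lra.
Qed.

End CircuitInequality.

(** * Sufficiency *)

Section Sufficiency.
Variables (R : realType) (n : nat) (alpha : 'I_n -> 'X_{1..n}) (y : 'X_{1..n}).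
Variables (tau : 'I_n -> R) (c : R).
Hypothesis A_unit : vertex_mx R alpha \in unitmx.
Hypothesis alpha_even : forall j, even_mnm (alpha j).
Hypothesis tau_gt0 : forall i, 0 < tau i.
Hypothesis y_ge0 : forall j, 0 <= bary R alpha y 0 j.
Hypothesis y_le1 : \sum_j bary R alpha y 0 j <= 1.

Let f := simplex_interpolant alpha tau y + c *: scaled_mon tau y.

Lemma even_scaled_mon_sbs m : even_mnm m -> sum_binomial_squares (scaled_mon tau m).
Proof.
move=> /even_mnm_double ->; set h := [multinom _ | _ < _].
rewrite scaled_monD -expr2 -[scaled_mon tau h]addr0 -(scale0r 'X_[h]).
exact: sbs_binomial.
Qed.

Lemma simplex_interpolant_sbs : sum_binomial_squares (simplex_interpolant alpha tau y).
Proof.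
apply: sbsD.
  rewrite -[_%:MP]mulr1 mul_mpolyC -(scaled_mon0 tau).
  by apply: sbsZ; [rewrite subr_ge0|apply: even_scaled_mon_sbs => i; rewrite mnm0E].
by apply: sbs_sum => j; apply: sbsZ => //; exact: even_scaled_mon_sbs.
Qed.

(** If c > 0 and y is even, every term of f is a nonnegative multiple of
the square of a monomial.  Otherwise nonnegativity gives |c| <= 1, and f is a convex
combination of its interpolant and of the extreme case in which c is replaced by its
sign. *)
Lemma circuit_sbs : (forall x, 0 <= f.@[x]) ->
  Delta_star R alpha (mnm_pt y) \/ (0 < c /\ even_mnm y) ->
  sum_binomial_squares f.
Proof.
move=> f0; have [[c0 ey] _|cy [[L mL Ly]|//]] := pselect (0 < c /\ even_mnm y).
  apply: sbsD; first exact: simplex_interpolant_sbs.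
  by apply: sbsZ; [exact: ltW | exact: even_scaled_mon_sbs].
have mix a (h : {mpoly R[n]}) : 0 <= a <= 1 ->
    sum_binomial_squares (simplex_interpolant alpha tau y + h) ->
    sum_binomial_squares (simplex_interpolant alpha tau y + a *: h).
  move=> /andP[a0 a1] hsbs.
  have -> : simplex_interpolant alpha tau y + a *: h =
      (1 - a) *: simplex_interpolant alpha tau y
      + a *: (simplex_interpolant alpha tau y + h).
    by rewrite (scalerDr a) addrA -scalerDl subrK scale1r.
  by apply: sbsD; apply: sbsZ => //; [rewrite subr_ge0|exact: simplex_interpolant_sbs].
have [c0|c0] := leP c 0.
  rewrite /f -[c]opprK scaleNr -scalerN; apply: mix.
    by rewrite oppr_ge0 c0 lerNl (circuit_coef_geN1 tau_gt0 alpha_even f0).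
  have := agiform_sbs tau A_unit mL Ly; exact.
have ey : ~ even_mnm y by move=> ey; apply: cy.
apply: mix; first by rewrite ltW// (circuit_coef_le1 tau_gt0 alpha_even f0).
apply: (flipped_agiform_sbs tau A_unit mL) => // /verticesP[y0|[j yj]].
  by apply: ey => i; rewrite y0 mnm0E.
by apply: ey; rewrite yj.
Qed.

End Sufficiency.

Theorem theorem5p2 (R : realType) (n d : nat)
    (alpha : 'I_n -> 'X_{1..n}) (y : 'X_{1..n})
    (lambda0 : R) (lambda : 'I_n -> R) (b : 'I_n -> R) (c : R)
    (f : {mpoly R[n]}) :
  even_simplex R alpha ->
  interior (simplex R alpha) (real_pt R (mnm_pt y)) ->
  real_pt R (mnm_pt y) = \sum_(j < n) lambda j *: real_pt R (mnm_pt (alpha j)) ->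
  (forall j, 0 < lambda j) ->
  lambda0 = 1 - \sum_(j < n) lambda j ->
  0 < lambda0 ->
  (forall j, 0 < b j) ->
  c != 0 ->
  f = lambda0%:MP + \sum_(j < n) b j *: 'X_[alpha j] + c *: 'X_[y] ->
  Psd_Delta d alpha y f ->
  (Sos_Delta d alpha y f <->
     Delta_star R alpha (mnm_pt y) \/ (0 < c /\ even_mnm y)) /\
  (Sos_Delta d alpha y f -> sum_binomial_squares f).
Proof.
move=> simpl _ yE lambda_gt0 l0E l0_gt0 b_gt0 c_neq0 fE [[fdeg f_ge0] fP].
have A_unit := vertex_mx_unit simpl; have [_ alpha_even] := simpl.
have yb := bary_unique A_unit yE.
have y_ge0 j : 0 <= bary R alpha y 0 j by rewrite yb ltW.
have ybs : \sum_j bary R alpha y 0 j = \sum_j lambda j.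
  by apply: eq_bigr => j _; exact: yb.
have y_le1 : \sum_j bary R alpha y 0 j <= 1 by rewrite ybs -subr_ge0 -l0E ltW.
have v_gt0 j : 0 < b j / lambda j by rewrite divr_gt0.
have [tau tau_gt0 tauE] := monomial_value_interpolation A_unit v_gt0.
have k_gt0 : 0 < 'X_[y].@[tau].
  by rewrite mevalX prodr_gt0// => i _; rewrite exprn_gt0.
have fE' : f = simplex_interpolant alpha tau y + (c / 'X_[y].@[tau]) *: scaled_mon tau y.
  rewrite fE /simplex_interpolant ybs -l0E; congr (_ + _ + _).
    apply: eq_bigr => j _; rewrite yb /scaled_mon tauE scalerA.
    by rewrite mulrC divfK// gt_eqF.
  by rewrite /scaled_mon scalerA divfK// gt_eqF.
have sufficient : Delta_star R alpha (mnm_pt y) \/ (0 < c /\ even_mnm y) ->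
    sum_binomial_squares f.
  move=> H; rewrite fE'; apply: circuit_sbs => //; first by rewrite -fE'.
  by case: H => [|[c0 ey]]; [left|right; rewrite divr_gt0].
have necessary : Sos_Delta d alpha y f ->
    Delta_star R alpha (mnm_pt y) \/ (0 < c /\ even_mnm y).
  move=> [[s _ fs] _].
  have [cy|cy] := pselect (0 < c /\ even_mnm y); [by right|left].
  by apply: (sos_mediated (b0 := lambda0) (b := b) (s := s) _ A_unit y_ge0 y_le1
    c_neq0 cy); rewrite -fE.
split; last by move=> /necessary/sufficient.
by split=> // /sufficient fsbs; split=> //; exact: sbs_Sos.
Qed.
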